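(* Let $M\in\mathbb{S}^n$ be any real symmetric matrix with associated Schur–Horn orbitope $\mathcal{SH}(M)$, and let $W$ be an extreme point of $\mathcal{SH}(M)$. Then the normal cone $\mathcal{N}_{\mathcal{SH}(M)}(W)$ and its relative interior are given by $$\mathcal{N}_{\mathcal{SH}(M)}(W)=\{Q\in\mathbb{S}^n : Q \text{ and } W \text{ are spectrally comonotone}\},$$ $$\mathrm{relint}\left(\mathcal{N}_{\mathcal{SH}(M)}(W)\right)=\{Q\in\mathbb{S}^n : Q \text{ is strictly spectrally comonotone with } W\}.$$
   Context: $\mathbb{S}^n$ is the space of real symmetric $n\times n$ matrices with inner product $\mathrm{trace}(AB)$. The Schur–Horn orbitope of $M\in\mathbb{S}^n$ is $\mathcal{SH}(M)=\mathrm{conv}\{UMU' : U \text{ an } n\times n \text{ orthogonal matrix}\}$. The normal cone $\mathcal{N}_{\mathcal{C}}(x)$ at a point $x$ of a closed convex set $\mathcal{C}$ is the set of linear functionals (identified with elements of the space via the inner product) that attain their maximum over $\mathcal{C}$ at $x$. $\mathrm{relint}$ denotes relative interior. Matrices $A,B\in\mathbb{S}^n$ are spectrally comonotone if there is an orthogonal matrix $U\in\mathbb{R}^{n\times n}$ such that $U'AU$ and $U'BU$ are both diagonal with diagonal entries sorted in nonincreasing order. $A\in\mathbb{S}^n$ is strictly spectrally comonotone with $B\in\mathbb{S}^n$ if for every $P\in\mathbb{S}^n$ that is simultaneously diagonalizable with $B$ there exists $\epsilon>0$ such that $A+\epsilon P$ and $B$ are spectrally comonotone. *)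

(* Defs.v *)
From HB Require Import structures.
From mathcomp Require Import all_boot all_order all_algebra.
From mathcomp Require Import all_classical all_reals all_analysis.

Set Implicit Arguments.
Unset Strict Implicit.
Unset Printing Implicit Defensive.

Import Order.TTheory GRing.Theory Num.Theory.
Import numFieldNormedType.Exports.

Local Open Scope classical_set_scope.
Local Open Scope ring_scope.

Section ConvexGeometry.
Context {R : realType}.

Definition affine_hull (E : lmodType R) (C : set E) : set E :=
  [set x | exists (k : nat) (t : 'I_k -> R) (p : 'I_k -> E),
     [/\ \sum_i t i = 1, forall i, C (p i) & x = \sum_i t i *: p i]].

Definition convex_hull (E : lmodType R) (C : set E) : set E :=
  [set x | exists (k : nat) (t : 'I_k -> R) (p : 'I_k -> E),
     [/\ forall i, 0 <= t i, \sum_i t i = 1, forall i, C (p i)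
       & x = \sum_i t i *: p i]].

Definition extreme_point (E : lmodType R) (C : set E) (x : E) : Prop :=
  C x /\ forall (y z : E) (t : R), C y -> C z -> 0 < t < 1 ->
    x = t *: y + (1 - t) *: z -> y = x /\ z = x.

Definition relint (E : normedModType R) (C : set E) : set E :=
  [set x | C x /\ \forall y \near x, affine_hull C y -> C y].

End ConvexGeometry.

Section SpectralComonotonicity.
Context {R : realType} {n : nat}.
Implicit Types A B C M P Q U W : 'M[R]_n.

Definition orthogonal_matrix U : Prop := U^T *m U = 1%:M.

Definition diag_nonincreasing A : Prop :=
  is_diag_mx A /\ forall i j : 'I_n, (i <= j)%N -> A j j <= A i i.

Definition spectrally_comonotone A B : Prop :=
  exists U, [/\ orthogonal_matrix U, diag_nonincreasing (U^T *m A *m U)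
              & diag_nonincreasing (U^T *m B *m U)].

Definition strictly_spectrally_comonotone A B : Prop :=
  forall P, P \is symmetricmx -> codiagonalizable [:: P; B] ->
    exists2 eps : R, 0 < eps & spectrally_comonotone (A + eps *: P) B.

Definition schur_horn M : set 'M[R]_n :=
  convex_hull [set U *m M *m U^T | U in orthogonal_matrix].

(* Normal cone in the space of symmetric matrices: the functional attached to
   Q is X |-> \tr (Q *m X).  Only meant for points W of K. *)
Definition normal_cone (K : set 'M[R]_n) W : set 'M[R]_n :=
  [set Q | Q \is symmetricmx /\
     forall X, K X -> \tr (Q *m X) <= \tr (Q *m W)].

End SpectralComonotonicity.

(* Main.v *)
Require Import Defs.
From mathcomp Require Import all_boot all_order all_algebra.
From mathcomp Require Import all_classical all_reals all_analysis.
From mathcomp Require Import ring lra.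

(**
An extreme point of a convex hull belongs to the generating set
([extreme_point_hull]), so W lies on the orbit of M, and SH(M) is the convex
hull of the orbit of W. A symmetric Q is therefore normal at W exactly when
tr(Q V W V^T) <= tr(Q W) for every orthogonal V, and the first equality says
that this happens exactly when Q and W are spectrally comonotone.

If Q and W are comonotone, both are diagonal in one basis with sorted spectra
q and w, and the left-hand side is the sum of q_i w_j V_ij^2, where the V_ij^2
form a doubly stochastic matrix. Maximizing over doubly stochastic matrices is
the assignment problem with payoff q_i w_j; explicit dual potentials
([dual_potential]) show that the identity assignment is optimal
([trace_rearrangement]).

For the converse, the trace is compared at V = 1 and at V = the reflection in
the hyperplane orthogonal to a vector u, a rational competitor that needs no
exponential of skew matrices. In an eigenbasis of Q, taking u = e_i + t e_j for
all t forces W_ij = 0 when q_i <> q_j, and (q_i - q_j) (W_ii - W_jj) >= 0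
([reflection_max_pair]). The first fact makes Q and W commute; in a common
eigenbasis the second one orders the spectra ([trace_le_comonotone]).

The same computation yields the spectral theorem. For A symmetric and N
diagonal with strictly decreasing entries, tr(N V^T A V) attains a maximum on
the compact orthogonal group, and at a maximizer V^T A V is diagonal and sorted.
Restricting V to the commutant of a diagonal matrix diag(b) gives the version
for a commuting pair: diag(b) is preserved, and the spectrum of A is sorted
inside each block on which b is constant ([spectral_commuting_diag]).

The relative interior rests on one quantitative fact ([comonotone_perturb]):
W + E is comonotone with W for every small symmetric E commuting with W, because
E preserves the eigenspaces of W and shifts eigenvalues too little to close the
gaps between distinct eigenvalues of W. Hence the affine hull of the normal
cone is the space of symmetric matrices commuting with W, which is also the
space of admissible directions P in the definition of strict comonotonicity. A
point Q of the relative interior can thus be moved slightly along any such P.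
Conversely, strict comonotonicity in the direction -W writes Q = Z + e W with Z
normal and e > 0, and then Q + E = Z + e (W + E / e) is normal for every small
E in the affine hull.
*)

Set Implicit Arguments.
Unset Strict Implicit.
Unset Printing Implicit Defensive.

Import Order.TTheory GRing.Theory Num.Theory.
Import numFieldNormedType.Exports.

Local Open Scope classical_set_scope.
Local Open Scope ring_scope.

(** * Orthogonal matrices and reflections *)

Section Orthogonal.
Context {R : realType} {n : nat}.
Implicit Types (A D S U V : 'M[R]_n) (u : 'cV[R]_n).

Lemma symmetricmxP A : A \is symmetricmx <-> A^T = A.
Proof.
rewrite is_hermitianmxE expr0 scale1r map_mx_id //.
by split=> [/eqP<-|->].
Qed.

Lemma orthogonalC U : orthogonal_matrix U -> U *m U^T = 1%:M.
Proof. exact: mulmx1C. Qed.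

Lemma orthogonalM U V :
  orthogonal_matrix U -> orthogonal_matrix V -> orthogonal_matrix (U *m V).
Proof.
rewrite /orthogonal_matrix trmx_mul => oU oV.
by rewrite mulmxA -(mulmxA _ U^T) oU mulmx1.
Qed.

Lemma orthogonalT U : orthogonal_matrix U -> orthogonal_matrix U^T.
Proof. by rewrite /orthogonal_matrix trmxK; apply: orthogonalC. Qed.

Lemma orthogonalKr m (A : 'M[R]_(m, n)) U :
  orthogonal_matrix U -> A *m U *m U^T = A.
Proof. by move=> /orthogonalC oU; rewrite -mulmxA oU mulmx1. Qed.

Lemma orthogonalKTr m (A : 'M[R]_(m, n)) U :
  orthogonal_matrix U -> A *m U^T *m U = A.
Proof. by move=> oU; rewrite -mulmxA oU mulmx1. Qed.

Lemma conj_diag U A D :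
  orthogonal_matrix U -> U^T *m A *m U = D <-> A = U *m D *m U^T.
Proof.
move=> oU; split=> [<-|->].
  by rewrite !mulmxA orthogonalC // mul1mx orthogonalKr.
by rewrite !mulmxA oU mul1mx orthogonalKTr.
Qed.

Lemma conjM U V A :
  (U *m V)^T *m A *m (U *m V) = V^T *m (U^T *m A *m U) *m V.
Proof. by rewrite trmx_mul !mulmxA. Qed.

Lemma conj_sym U A : A^T = A -> (U^T *m A *m U)^T = U^T *m A *m U.
Proof. by move=> sA; rewrite !trmx_mul trmxK sA mulmxA. Qed.

Lemma orthogonal_entry_le1 U i j : orthogonal_matrix U -> `|U i j| <= 1.
Proof.
move=> oU; have /matrixP/(_ j j) := oU; rewrite !mxE eqxx mulr1n => e.
rewrite -(@ler_pXn2r _ 2) ?nnegrE // expr1n -normrX ger0_norm ?sqr_ge0 // -e.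
rewrite (bigD1 i) //= !mxE -expr2 lerDl sumr_ge0 // => k _.
by rewrite mxE -expr2 sqr_ge0.
Qed.

Definition reflection u : 'M[R]_n := 1%:M - (2 / (u^T *m u) 0 0) *: (u *m u^T).

Lemma reflectionT u : (reflection u)^T = reflection u.
Proof. by rewrite linearB /= trmx1 linearZ /= trmx_mul trmxK. Qed.

Lemma mulmx_outer u S :
  u *m u^T *m S *m (u *m u^T) = (u^T *m S *m u) 0 0 *: (u *m u^T).
Proof.
rewrite !mulmxA -(mulmxA u u^T S) -(mulmxA u _ u).
by rewrite [X in u *m X]mx11_scalar mul_mx_scalar scalemxAl.
Qed.

Lemma reflection_orthogonal u :
  (u^T *m u) 0 0 != 0 -> orthogonal_matrix (reflection u).
Proof.
move=> u0; rewrite /orthogonal_matrix reflectionT /reflection.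
have := mulmx_outer u 1%:M; rewrite !mulmx1.
set c : R := (u^T *m u) 0 0 in u0 *; set P := u *m u^T => PP.
rewrite mulmxBl !mulmxBr !mul1mx mulmx1 -scalemxAl -scalemxAr PP !scalerA.
rewrite -addrA -opprD -scalerBl -scalerDl.
rewrite (_ : 2 / c + _ = 0) ?scale0r ?subr0 //.
by field.
Qed.

(** With H the reflection and P the rank-one projection onto u, expanding
    H = 1 - 2 P gives tr(D H S H) - tr(D S) = 4 (tr(D P S P) - tr(D S P)). As P has
    rank one, the first trace on the right is a product of two quadratic forms at
    u and the second one is a single form, up to powers of |u|^2. *)
Lemma reflection_trace u D S :
  D^T = D -> S^T = S -> (u^T *m u) 0 0 != 0 ->
  \tr (D *m (reflection u *m S *m (reflection u)^T)) <= \tr (D *m S) ->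
  (u^T *m D *m u) 0 0 * (u^T *m S *m u) 0 0 <=
    (u^T *m u) 0 0 * (u^T *m S *m D *m u) 0 0.
Proof.
move=> sD sS u0; rewrite reflectionT /reflection.
have cgt0 : 0 < (u^T *m u) 0 0.
  rewrite lt0r u0 mxE sumr_ge0 // => k _.
  by rewrite mxE -expr2 sqr_ge0.
set c : R := (u^T *m u) 0 0 in u0 cgt0 *.
have trP (X : 'M[R]_n) : \tr (X *m (u *m u^T)) = (u^T *m X *m u) 0 0.
  by rewrite mulmxA mxtrace_mulC mulmxA /mxtrace big_ord1.
have sQ : (u^T *m D *m S *m u) 0 0 = (u^T *m S *m D *m u) 0 0.
  transitivity ((u^T *m D *m S *m u)^T 0 0); first by rewrite [RHS]mxE.
  by rewrite !trmx_mul trmxK sS sD !mulmxA.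
rewrite !(mulmxBl, mulmxBr) !mul1mx !mulmx1.
rewrite -!(scalemxAl, scalemxAr) mulmx_outer -!scalemxAr.
rewrite !raddfB /= !mxtraceZ (mulmxA D S).
rewrite (mulmxA D _ S) [\tr (D *m _ *m S)]mxtrace_mulC (mulmxA S D) !trP !mulmxA sQ.
set q : R := (u^T *m S *m D *m u) 0 0; set a : R := (_ *m D *m u) 0 0.
set s : R := (_ *m S *m u) 0 0 => H.
suff : 4 / c ^+ 2 * (a * s - c * q) <= 0.
  by rewrite pmulr_rle0 ?divr_gt0 ?exprn_gt0 // subr_le0.
rewrite (_ : _ * _ = 2 / c * (2 / c * (s * a)) - 2 / c * q - 2 / c * q); first lra.
by field.
Qed.

End Orthogonal.

(** * Reflections as competitors in a trace maximization *)

(** Near 0 the expression behaves like t a, which changes sign unless a = 0; at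
    t = 1 only b is left. The loss caused by the reflection in e_i + t e_j has
    this shape. *)
Lemma odd_even_nonneg_coefs {R : realFieldType} (a b : R) :
  (forall t : R, 0 <= t * (1 - t ^+ 2) * a + t ^+ 2 * b) -> a = 0 /\ 0 <= b.
Proof.
move=> H; have b0 : 0 <= b by have := H 1; lra.
split=> //; apply/eqP/negP => /negP a0.
have a2 : 0 < a ^+ 2 by rewrite exprn_even_gt0.
(* t = - a / K makes the linear term negative; K is large enough for |t| <= 1/2
   and for the linear term to dominate. *)
pose K := 2 * (b + 1 + a ^+ 2).
have K0 : 0 < K by rewrite /K; lra.
have := H (- a / K).
suff : - a / K * (1 - (- a / K) ^+ 2) * a + (- a / K) ^+ 2 * b < 0 by lra.
have -> : - a / K * (1 - (- a / K) ^+ 2) * a + (- a / K) ^+ 2 * b =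
    - (a ^+ 2 / K ^+ 2 * (K * (1 - a ^+ 2 / K ^+ 2) - b)).
  by field; rewrite gt_eqF.
rewrite oppr_lt0 pmulr_rgt0 ?divr_gt0 ?(exprn_gt0 _ K0) // subr_gt0.
have t2 : a ^+ 2 / K ^+ 2 <= 1 / 4.
  by rewrite ler_pdivrMr ?exprn_gt0 // /K; nra.
have : K * (3 / 4) <= K * (1 - a ^+ 2 / K ^+ 2) by rewrite ler_pM2l //; lra.
by rewrite /K in K0 *; lra.
Qed.

Section Pair.
Context {R : realType} {n : nat}.
Implicit Types (S : 'M[R]_n) (d : 'rV[R]_n).

Definition pair_vector (i j : 'I_n) (t : R) : 'cV[R]_n :=
  delta_mx i 0 + t *: delta_mx j 0.

Lemma pair_vector_form i j t S :
  ((pair_vector i j t)^T *m S *m pair_vector i j t) 0 0 =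
    S i i + t * (S i j + S j i) + t ^+ 2 * S j j.
Proof.
rewrite /pair_vector [(_ + _)^T]raddfD /= trmx_delta linearZ /= trmx_delta.
rewrite !(mulmxDl, mulmxDr) -!(scalemxAl, scalemxAr) -!rowE -!colE !mxE.
ring.
Qed.

Lemma pair_vector_norm i j t : i != j ->
  ((pair_vector i j t)^T *m pair_vector i j t) 0 0 = 1 + t ^+ 2.
Proof.
move=> ij; have := pair_vector_form i j t 1%:M.
rewrite mulmx1 !mxE !eqxx (eq_sym j) (negPf ij) => ->.
by rewrite mulr1n mulr0n; ring.
Qed.

(** Small t, where the reflection in e_i + t e_j is close to the one in e_i, gives
    a first-order condition that kills the entry (i, j); t = 1 exchanges the
    coordinates i and j up to sign and compares the diagonal entries. *)
Lemma reflection_max_pair d S (i j : 'I_n) :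
  S^T = S -> i != j ->
  (forall t, let V := reflection (pair_vector i j t) in
    \tr (diag_mx d *m (V *m S *m V^T)) <= \tr (diag_mx d *m S)) ->
  (d 0 i != d 0 j -> S i j = 0) /\ 0 <= (d 0 i - d 0 j) * (S i i - S j j).
Proof.
move=> sS ij H.
have sji : S j i = S i j by rewrite -{1}sS mxE.
have [a0 b0] : S i j * (d 0 j - d 0 i) = 0 /\ 0 <= (d 0 i - d 0 j) * (S i i - S j j).
  apply: odd_even_nonneg_coefs => t.
  have := @reflection_trace _ _ (pair_vector i j t) (diag_mx d) S.
  rewrite pair_vector_norm // tr_diag_mx gt_eqF ?ltr_wpDr ?sqr_ge0 //.
  move=> /(_ erefl sS isT (H t)).
  rewrite -(mulmxA _ S (diag_mx d)) !pair_vector_form !mul_mx_diag !mxE !eqxx sji.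
  rewrite (eq_sym j) (negPf ij) !mulr1n !mulr0n.
  lra.
split=> // dij; move/eqP: a0; rewrite mulf_eq0 subr_eq0 [d 0 j == _]eq_sym.
by rewrite (negPf dij) orbF => /eqP.
Qed.

End Pair.

(** * Maximizers over compact groups of orthogonal matrices *)

Section Compactness.
Context {R : realType}.

(** Matrix products of mixed sizes are polynomial in the entries, so continuity
    is tracked entry by entry and only the scalar laws are used. *)
Definition entrywise_continuous (T : topologicalType) m n
  (F : T -> 'M[R]_(m, n)) := forall i j, continuous (fun x => F x i j).

Lemma entrywise_continuous_sum (T : topologicalType) n (f : 'I_n -> T -> R) :
  (forall i, continuous (f i)) -> continuous (fun x => \sum_i f i x).
Proof.
move=> cf; apply: continuous_big => // -[x y].
by apply: cvgD; [exact: cvg_fst | exact: cvg_snd].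
Qed.

Lemma entrywise_continuousM (T : topologicalType) m n p
    (F : T -> 'M[R]_(m, n)) (G : T -> 'M[R]_(n, p)) :
  entrywise_continuous F -> entrywise_continuous G ->
  entrywise_continuous (fun x => F x *m G x).
Proof.
move=> cF cG i j; under eq_fun do rewrite mxE.
apply: entrywise_continuous_sum => k x.
by apply: cvgM; [exact: cF | exact: cG].
Qed.

Lemma entrywise_continuousT (T : topologicalType) m n (F : T -> 'M[R]_(m, n)) :
  entrywise_continuous F -> entrywise_continuous (fun x => (F x)^T).
Proof. by move=> cF i j; under eq_fun do rewrite mxE; exact: cF. Qed.

Lemma entrywise_continuous_cst (T : topologicalType) m n (A : 'M[R]_(m, n)) :
  entrywise_continuous (fun _ : T => A).
Proof. by move=> i j; exact: cst_continuous. Qed.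

Lemma entrywise_continuous_trace (T : topologicalType) n (F : T -> 'M[R]_n) :
  entrywise_continuous F -> continuous (fun x => \tr (F x)).
Proof. by move=> cF; apply: entrywise_continuous_sum => i; exact: cF. Qed.

Lemma vec_mx_entrywise_continuous m n :
  entrywise_continuous (@vec_mx R m n).
Proof. by move=> i j; under eq_fun do rewrite mxE; exact: coord_continuous. Qed.

Lemma entrywise_closed_eq (T : topologicalType) m n (F G : T -> 'M[R]_(m, n)) :
  entrywise_continuous F -> entrywise_continuous G ->
  closed [set x | F x = G x].
Proof.
move=> cF cG.
have -> : [set x | F x = G x] =
    \bigcap_(ij in setT) ((fun x => F x ij.1 ij.2 - G x ij.1 ij.2) @^-1` [set y | y = 0]).
  apply/seteqP; split=> x /= => [FG [i j] _ /=|H]; first by rewrite FG subrr.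
  by apply/matrixP => i j; apply/eqP; rewrite -subr_eq0; apply/eqP/(H (i, j)).
apply: closed_bigI => -[i j] _ /=.
apply: preimage_closed; last exact: closed_eq.
by move=> x _ /=; apply: cvgB; [exact: cF | exact: cG].
Qed.

(** The constraint set is closed and its entries are bounded by 1. Compactness
    is used on row vectors, to which [mxvec] transports the set. *)
Lemma orthogonal_commutant_argmax n (D N A : 'M[R]_n) :
  exists V, [/\ orthogonal_matrix V, V *m D = D *m V &
    forall V', orthogonal_matrix V' -> V' *m D = D *m V' ->
      \tr (N *m (V'^T *m A *m V')) <= \tr (N *m (V^T *m A *m V))].
Proof.
pose G := [set x : 'rV[R]_(n * n) | (vec_mx x)^T *m vec_mx x = 1%:M] `&`
          [set x : 'rV[R]_(n * n) | vec_mx x *m D = D *m vec_mx x].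
pose f (x : 'rV[R]_(n * n)) := \tr (N *m ((vec_mx x)^T *m A *m vec_mx x)).
have cv := @vec_mx_entrywise_continuous n n.
have cc := @entrywise_continuous_cst ('rV[R]_(n * n)) n n.
have cVV : entrywise_continuous (fun x : 'rV[R]_(n * n) => (vec_mx x)^T *m vec_mx x).
  by apply: entrywise_continuousM => //; exact: entrywise_continuousT.
have cf : continuous f.
  apply: (@entrywise_continuous_trace _ _ (fun x => N *m _)).
  apply: entrywise_continuousM => //; apply: entrywise_continuousM => //.
  by apply: entrywise_continuousM => //; exact: entrywise_continuousT.
have G0 : G !=set0.
  by exists (mxvec 1%:M); split; rewrite /= mxvecK ?trmx1 ?mul1mx ?mulmx1.
have clG : closed G.
  by apply: closedI; apply: entrywise_closed_eq => //; exact: entrywise_continuousM.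
have bG : bounded_set G.
  exists 1; split=> // M M1 x [/= ox _].
  rewrite [leLHS]/Num.norm /= mx_normrE; apply/bigmax_leP.
  split=> [|[i k] _ /=]; first by rewrite (le_trans _ (ltW M1)).
  rewrite (ord1 i); case/mxvec_indexP: k => k l.
  have := @orthogonal_entry_le1 _ _ _ k l ox.
  by rewrite mxE => /le_trans; apply; rewrite ltW.
have [|x] := @EVT_max_rV R _ f G G0 (bounded_closed_compact bG clG).
  exact: continuous_subspaceT.
rewrite inE => -[/= ox cx] H; exists (vec_mx x); split=> // V' oV' cV'.
have := H (mxvec V'); rewrite /f mxvecK; apply.
by rewrite inE /G /=; split; rewrite /= mxvecK.
Qed.

End Compactness.

(** * Spectral theorem for one symmetric matrix and for a commuting pair *)

Section Spectral.
Context {R : realType} {n : nat}.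
Implicit Types (A B U V : 'M[R]_n) (a b d : 'rV[R]_n).

(** V maximizes tr(N V^T A V) over the orthogonal V commuting with diag(b), where
    N is diagonal with distinct decreasing entries. If b_i = b_j, the
    reflection in e_i + t e_j commutes with diag(b), hence V followed by it is a
    competitor and [reflection_max_pair] applies. If b_i <> b_j, the entry (i, j)
    of V^T A V vanishes because that matrix commutes with diag(b). *)
Lemma spectral_commuting_diag A b :
  A^T = A -> A *m diag_mx b = diag_mx b *m A ->
  exists V a, [/\ orthogonal_matrix V, V *m diag_mx b = diag_mx b *m V,
    V^T *m A *m V = diag_mx a &
    forall i j : 'I_n, (i <= j)%N -> b 0 i = b 0 j -> a 0 j <= a 0 i].
Proof.
move=> sA cA; pose d : 'rV[R]_n := \row_k - (k : nat)%:R.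
have [V [oV cV maxV]] := orthogonal_commutant_argmax (diag_mx b) (diag_mx d) A.
have cVT : V^T *m diag_mx b = diag_mx b *m V^T.
  by rewrite -[in LHS](tr_diag_mx b) -trmx_mul -cV trmx_mul tr_diag_mx.
set S := V^T *m A *m V in maxV.
have sS : S^T = S by exact: conj_sym.
have cS : S *m diag_mx b = diag_mx b *m S.
  by rewrite /S -mulmxA cV mulmxA -(mulmxA _ A) cA mulmxA cVT !mulmxA.
have plane (i j : 'I_n) : i != j -> b 0 i = b 0 j ->
    S i j = 0 /\ 0 <= (d 0 i - d 0 j) * (S i i - S j j).
  move=> ij bij.
  have [|S0 S1] := @reflection_max_pair _ _ d S i j sS ij.
    move=> t; set u := pair_vector i j t; set H := reflection u; rewrite /=.
    have u0 : (u^T *m u) 0 0 != 0.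
      by rewrite pair_vector_norm // gt_eqF ?ltr_wpDr ?sqr_ge0.
    have bu : diag_mx b *m u = b 0 i *: u.
      rewrite mul_diag_mx /u; apply/matrixP => k l; rewrite !mxE.
      have [->|ki] := eqVneq k i; first by [].
      have [->|kj] := eqVneq k j; first by rewrite bij.
      by rewrite /= !(mulr0, addr0).
    rewrite (_ : H *m S *m _ = (V *m H)^T *m A *m (V *m H)); last first.
      by rewrite trmx_mul reflectionT /S !mulmxA.
    apply: maxV.
      by apply: orthogonalM => //; exact: reflection_orthogonal.
    rewrite -mulmxA; have -> : H *m diag_mx b = diag_mx b *m H;
      last by rewrite !mulmxA cV.
    have ub : u^T *m diag_mx b = b 0 i *: u^T.
      by rewrite -[diag_mx b]tr_diag_mx -trmx_mul bu linearZ.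
    rewrite /H /reflection mulmxBl mulmxBr mul1mx mulmx1 -scalemxAl -scalemxAr.
    by rewrite mulmxA bu -mulmxA ub -scalemxAl -scalemxAr.
  split=> //; apply: S0; rewrite !mxE eqr_opp eqr_nat.
  by apply: contra ij => /eqP /val_inj ->.
have Sdiag (i j : 'I_n) : i != j -> S i j = 0.
  move=> ij; have [bij|bij] := eqVneq (b 0 i) (b 0 j).
    by case: (plane i j ij bij).
  have /matrixP/(_ i j) := cS; rewrite mul_mx_diag mul_diag_mx !mxE => /eqP.
  rewrite mulrC -subr_eq0 -mulrBl mulf_eq0 subr_eq0 eq_sym (negPf bij) /=.
  by move/eqP.
exists V, (\row_k S k k); split=> //.
  apply/matrixP => i j; rewrite [RHS]mxE [(\row__ _) _ _]mxE.
  have [->|/Sdiag->] := eqVneq i j.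
    by rewrite mulr1n.
  by rewrite mulr0n.
move=> i j ij bij; rewrite !mxE; move: ij; rewrite leq_eqVlt => /orP[/eqP/val_inj->//|ij].
have [|_] := plane i j _ bij; first by rewrite -val_eqE neq_ltn ij.
by rewrite !mxE pmulr_rge0 ?subr_ge0 // opprK addrC subr_gt0 ltr_nat.
Qed.

Lemma spectral A :
  A^T = A -> exists U a, [/\ orthogonal_matrix U, U^T *m A *m U = diag_mx a &
    forall i j : 'I_n, (i <= j)%N -> a 0 j <= a 0 i].
Proof.
move=> sA; have [|V [a [oV _ dV aP]]] := @spectral_commuting_diag A 0 sA.
  by rewrite raddf0 mulmx0 mul0mx.
by exists V, a; split=> // i j ij; apply: aP => //; rewrite !mxE.
Qed.

(** The eigenvalues b of B, with their order, are kept: only the basis inside the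
    eigenspaces of B is changed. *)
Lemma spectral_refine A B U b :
  orthogonal_matrix U -> U^T *m B *m U = diag_mx b ->
  A^T = A -> A *m B = B *m A ->
  exists U' a, [/\ orthogonal_matrix U', U'^T *m B *m U' = diag_mx b,
    U'^T *m A *m U' = diag_mx a &
    forall i j : 'I_n, (i <= j)%N -> b 0 i = b 0 j -> a 0 j <= a 0 i].
Proof.
move=> oU dB sA cA.
have [||V [a [oV cV dV aP]]] := @spectral_commuting_diag (U^T *m A *m U) b.
- exact: conj_sym.
- rewrite -dB !mulmxA !orthogonalKr // -!mulmxA; congr (_ *m _).
  by rewrite !mulmxA cA.
exists (U *m V), a; split=> //; first exact: orthogonalM.
- by rewrite conjM dB -mulmxA -cV mulmxA oV mul1mx.
- by rewrite conjM.
Qed.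

End Spectral.

(** * Spectral comonotonicity as optimality of a trace *)

(** The potential u is the discrete integral of g against df, that is
    u_k = sum over l < k of (f_(l+1) - f_l) g_l. Since df <= 0 and g is
    nonincreasing, replacing g_l by g_j in the sum between i and j can only
    decrease u_i - u_j, whichever of i and j is larger. Then u_i and
    v_j = f_j g_j - u_j are feasible for the dual of the assignment problem with
    payoff f_i g_j, and they are tight on the diagonal. *)
Lemma dual_potential {R : realDomainType} (n : nat) (f g : nat -> R) :
  (forall i j, (i <= j < n)%N -> f j <= f i) ->
  (forall i j, (i <= j < n)%N -> g j <= g i) ->
  exists u : nat -> R, forall i j, (i < n)%N -> (j < n)%N ->
    (f i - f j) * g j <= u i - u j.
Proof.
move=> fP gP; pose u k := \sum_(0 <= l < k) (f l.+1 - f l) * g l.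
have step j l : (j < n)%N -> (l.+1 < n)%N ->
    if (j <= l)%N then (f l.+1 - f l) * g j <= (f l.+1 - f l) * g l
    else (f l.+1 - f l) * g l <= (f l.+1 - f l) * g j.
  move=> jn ln; have fl : f l.+1 - f l <= 0 by rewrite subr_le0 fP // leqnSn.
  case: leqP => jl; rewrite ler_wnM2l // gP //.
    by rewrite jl ltnW.
  by rewrite ltnW.
exists u => i j iN jN.
have [ij|/ltnW ji] := leqP i j.
  have -> : u i - u j = - \sum_(i <= l < j) (f l.+1 - f l) * g l.
    by rewrite /u (big_cat_nat (leq0n i) ij) //= opprD addrA subrr add0r.
  rewrite -opprB mulNr lerN2 -telescope_sumr // mulr_suml !big_seq.
  apply: ler_sum => l; rewrite mem_index_iota => /andP[_ lj].
  have := step j l jN (leq_ltn_trans lj jN).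
  by rewrite leqNgt lj.
have -> : u i - u j = \sum_(j <= l < i) (f l.+1 - f l) * g l.
  by rewrite /u (big_cat_nat (leq0n j) ji) //= addrAC subrr add0r.
rewrite -telescope_sumr // mulr_suml !big_seq.
apply: ler_sum => l; rewrite mem_index_iota => /andP[jl li].
have := step j l jN (leq_ltn_trans li iN).
by rewrite jl.
Qed.

Section Comonotone.
Context {R : realType} {n : nat}.
Implicit Types (A Q U V W : 'M[R]_n) (a b d : 'rV[R]_n).

Lemma diag_nonincreasing_diag d :
  (forall i j : 'I_n, (i <= j)%N -> d 0 j <= d 0 i) ->
  diag_nonincreasing (diag_mx d).
Proof.
move=> dP; split=> [|i j ij]; first exact: diag_mx_is_diag.
by rewrite !mxE !eqxx; exact: dP.
Qed.

Lemma diag_nonincreasingE A : diag_nonincreasing A ->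
  exists2 d : 'rV_n, A = diag_mx d & forall i j : 'I_n, (i <= j)%N -> d 0 j <= d 0 i.
Proof.
move=> [/diag_mxP[d ->] dP]; exists d => // i j /dP.
by rewrite !mxE !eqxx.
Qed.

Lemma orthogonal_row_sum U (i : 'I_n) : orthogonal_matrix U -> \sum_j U i j ^+ 2 = 1.
Proof.
move=> /orthogonalC /matrixP /(_ i i); rewrite !mxE eqxx mulr1n => <-.
by apply: eq_bigr => j _; rewrite mxE expr2.
Qed.

(** Weak duality: the trace on the left averages a_i b_j with the doubly stochastic
    weights V_ij^2, and a_i b_j <= u_i + (a_j b_j - u_j), whose average depends
    on the row and column sums alone. *)
Lemma trace_rearrangement a b V :
  (forall i j : 'I_n, (i <= j)%N -> a 0 j <= a 0 i) ->
  (forall i j : 'I_n, (i <= j)%N -> b 0 j <= b 0 i) ->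
  orthogonal_matrix V ->
  \tr (diag_mx a *m (V *m diag_mx b *m V^T)) <= \tr (diag_mx a *m diag_mx b).
Proof.
move=> aP bP oV.
have [u uP] : exists u : 'I_n -> R, forall i j : 'I_n,
    (a 0 i - a 0 j) * b 0 j <= u i - u j.
  pose ext (c : 'rV[R]_n) k := oapp (fun i : 'I_n => c 0 i) 0 (insub k).
  have extE c (i : 'I_n) : ext c i = c 0 i by rewrite /ext valK.
  have extP (c : 'rV[R]_n) : (forall i j : 'I_n, (i <= j)%N -> c 0 j <= c 0 i) ->
      forall i j, (i <= j < n)%N -> ext c j <= ext c i.
    move=> cP i j /andP[ij jn].
    by have := cP (Ordinal (leq_ltn_trans ij jn)) (Ordinal jn) ij; rewrite -!extE.
  have [u uP] := dual_potential (extP _ aP) (extP _ bP).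
  by exists (fun i => u i) => i j; rewrite -!extE; exact: uP.
pose s i j := V i j ^+ 2.
have row1 i : \sum_j s i j = 1 by exact: orthogonal_row_sum.
have col1 j : \sum_i s i j = 1.
  rewrite -[RHS](orthogonal_row_sum j (orthogonalT oV)).
  by apply: eq_bigr => i _; rewrite mxE.
have -> : \tr (diag_mx a *m (V *m diag_mx b *m V^T)) =
    \sum_i \sum_j s i j * (a 0 i * b 0 j).
  rewrite /mxtrace; apply: eq_bigr => i _.
  rewrite mul_diag_mx mul_mx_diag !mxE mulr_sumr; apply: eq_bigr => j _.
  by rewrite !mxE /s; ring.
have -> : \tr (diag_mx a *m diag_mx b) = \sum_i a 0 i * b 0 i.
  rewrite /mxtrace; apply: eq_bigr => i _.
  by rewrite mul_diag_mx !mxE eqxx mulr1n.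
(* Dual feasibility of the potentials u_i and a_j b_j - u_j. *)
apply: (@le_trans _ _ (\sum_i \sum_j s i j * (u i + (a 0 j * b 0 j - u j)))).
  apply: ler_sum => i _; apply: ler_sum => j _.
  by rewrite ler_wpM2l ?sqr_ge0 //; have := uP i j; lra.
under eq_bigr do (under eq_bigr do rewrite mulrDr;
  rewrite big_split /= -mulr_suml row1 mul1r).
rewrite big_split /= exchange_big /=.
under [X in _ + X]eq_bigr do rewrite -mulr_suml col1 mul1r.
by rewrite -big_split /= ler_sum // => i _; rewrite addrC subrK.
Qed.

Lemma comonotone_commute Q W : spectrally_comonotone Q W -> Q *m W = W *m Q.
Proof.
move=> [U [oU]] /diag_nonincreasingE[q + _] /diag_nonincreasingE[w + _].
move=> /conj_diag-/(_ oU)-> /conj_diag-/(_ oU)->.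
rewrite !mulmxA !orthogonalKTr //; congr (_ *m _).
by rewrite -!mulmxA diag_mxC.
Qed.

Lemma comonotone_trace_le Q W V :
  spectrally_comonotone Q W -> orthogonal_matrix V ->
  \tr (Q *m (V *m W *m V^T)) <= \tr (Q *m W).
Proof.
move=> [U [oU]] /diag_nonincreasingE[q + qP] /diag_nonincreasingE[w + wP] oV.
move=> /conj_diag-/(_ oU)-> /conj_diag-/(_ oU)->.
have := trace_rearrangement qP wP (orthogonalM (orthogonalM (orthogonalT oU) oV) oU).
congr (_ <= _).
  by rewrite !trmx_mul trmxK -!mulmxA [RHS]mxtrace_mulC !mulmxA.
by rewrite !mulmxA orthogonalKTr // [RHS]mxtrace_mulC !mulmxA oU mul1mx.
Qed.

(** The eigenbasis of Q yields commutation; a basis that diagonalizes both, with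
    the spectrum of W sorted and that of Q sorted inside the ties of W, then
    leaves only pairs with w_i > w_j to order, which [reflection_max_pair]
    does. *)
Lemma trace_le_comonotone Q W :
  Q^T = Q -> W^T = W ->
  (forall V, orthogonal_matrix V -> \tr (Q *m (V *m W *m V^T)) <= \tr (Q *m W)) ->
  spectrally_comonotone Q W.
Proof.
move=> sQ sW H.
have plane U q (i j : 'I_n) : orthogonal_matrix U ->
    U^T *m Q *m U = diag_mx q -> i != j ->
    (q 0 i != q 0 j -> (U^T *m W *m U) i j = 0) /\
    0 <= (q 0 i - q 0 j) * ((U^T *m W *m U) i i - (U^T *m W *m U) j j).
  move=> oU dQ ij; apply: reflection_max_pair => //; first exact: conj_sym.
  move=> t /=; set V := reflection _.
  have oV : orthogonal_matrix V.
    apply: reflection_orthogonal.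
    by rewrite pair_vector_norm // gt_eqF ?ltr_wpDr ?sqr_ge0.
  have := H _ (orthogonalM (orthogonalM oU oV) (orthogonalT oU)).
  move/conj_diag: (dQ) => /(_ oU) ->.
  congr (_ <= _).
    rewrite !trmx_mul trmxK -!mulmxA [LHS]mxtrace_mulC !mulmxA.
    by rewrite !orthogonalKTr.
  by rewrite -!mulmxA [LHS]mxtrace_mulC !mulmxA.
have cQW : Q *m W = W *m Q.
  have [U [q [oU dQ _]]] := spectral sQ.
  have : diag_mx q *m (U^T *m W *m U) = (U^T *m W *m U) *m diag_mx q.
    rewrite mul_diag_mx mul_mx_diag; apply/matrixP => i j; rewrite [LHS]mxE [RHS]mxE mulrC.
    have [->//|ij] := eqVneq i j.
    have [<-//|qij] := eqVneq (q 0 i) (q 0 j).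
    by have [/(_ qij)-> _] := plane U q i j oU dQ ij; rewrite !mul0r.
  rewrite -dQ !mulmxA !orthogonalKr // => e.
  have := congr1 (fun X => U *m X *m U^T) e.
  by rewrite !mulmxA !orthogonalC // !mul1mx !orthogonalKr.
have [U [w [oU dW wP]]] := spectral sW.
have [U' [q [oU' dW' dQ' qP]]] := spectral_refine oU dW sQ cQW.
exists U'; split=> //; rewrite ?dW' ?dQ'; apply: diag_nonincreasing_diag => // i j ij.
have [wij|wij] := eqVneq (w 0 i) (w 0 j); first exact: qP.
have [->//|nij] := eqVneq i j.
have [_] := plane U' q i j oU' dQ' nij.
rewrite dW' !mxE !eqxx !mulr1n pmulr_lge0 ?subr_ge0 // subr_gt0.
by rewrite lt_neqAle eq_sym wij wP.
Qed.

End Comonotone.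

(** * Stability of comonotonicity under commuting perturbations *)

Lemma finite_gap {R : realDomainType} (I : finType) (w : I -> R) :
  exists2 g, 0 < g & forall i j, w j < w i -> g <= w i - w j.
Proof.
exists (\big[Num.min/1]_(p : I * I | w p.2 < w p.1) (w p.1 - w p.2)).
  by apply: lt_bigmin => // p; rewrite subr_gt0.
move=> i j ij.
exact: (@bigmin_le_cond _ _ _ _ (i, j) (fun p : I * I => w p.2 < w p.1)
  (fun p => w p.1 - w p.2)).
Qed.

Section Perturbation.
Context {R : realType} {n : nat}.
Implicit Types (E V W : 'M[R]_n) (e : 'rV[R]_n).

(** The Frobenius norm is invariant under V, so e_i^2 <= sum of the E_kl^2. *)
Lemma diag_entry_le E V e (c : R) i :
  E^T = E -> orthogonal_matrix V -> V^T *m E *m V = diag_mx e ->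
  0 <= c -> (forall k l, `|E k l| <= c) -> `|e 0 i| <= n%:R * c.
Proof.
move=> sE oV dE c0 Ec.
have frob : \sum_k e 0 k ^+ 2 = \sum_k \sum_l E k l ^+ 2.
  transitivity (\tr (diag_mx e *m diag_mx e)).
    by apply: eq_bigr => k _; rewrite mul_diag_mx !mxE eqxx mulr1n expr2.
  rewrite -dE !mulmxA orthogonalKr // -!mulmxA mxtrace_mulC -!mulmxA orthogonalC // mulmx1.
  apply: eq_bigr => k _; rewrite mxE; apply: eq_bigr => l _.
  by rewrite -{2}sE mxE expr2.
rewrite -(@ler_pXn2r _ 2) ?nnegrE ?mulr_ge0 // -normrX ger0_norm ?sqr_ge0 //.
apply: (@le_trans _ _ (\sum_k e 0 k ^+ 2)).
  by rewrite (bigD1 i) //= lerDl sumr_ge0 // => k _; rewrite sqr_ge0.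
rewrite frob; apply: (@le_trans _ _ (\sum_(k < n) \sum_(l < n) c ^+ 2)).
  apply: ler_sum => k _; apply: ler_sum => l _.
  by rewrite -(ger0_norm (sqr_ge0 (E k l))) normrX ler_pXn2r ?nnegrE.
by rewrite !sumr_const card_ord -mulrnA exprMn -natrX mulr_natl -mulnn.
Qed.

(** An eigenvalue of E is at most n c in absolute value, so two eigenvalues differ
    by at most 2 n c, which is at most every gap between distinct eigenvalues
    of W. On ties of W, [spectral_refine] sorts the spectrum of E. *)
Lemma comonotone_perturb W : W^T = W ->
  exists2 c : R, 0 < c & forall E, E^T = E -> E *m W = W *m E ->
    (forall i j, `|E i j| <= c) -> spectrally_comonotone (W + E) W.
Proof.
move=> sW; have [U [w [oU dW wP]]] := spectral sW.
have [g g0 gP] := finite_gap (fun i => w 0 i).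
pose c : R := g / (2 * (n%:R + 1)).
have n0 : 0 <= n%:R :> R by [].
have c0 : 0 < c by rewrite divr_gt0 // mulr_gt0 // ltr_wpDl.
have cg : 2 * (n%:R * c) <= g.
  have -> : g = 2 * (n%:R + 1) * c.
    by rewrite /c mulrC divfK // gt_eqF // mulr_gt0 // ltr_wpDl.
  by nra.
exists c => // E sE cE Ec.
have [V [e [oV dWV dE eP]]] := spectral_refine oU dW sE cE.
have ec i := diag_entry_le i sE oV dE (ltW c0) Ec.
exists V; split=> //; last by rewrite dWV; exact: diag_nonincreasing_diag.
rewrite mulmxDr mulmxDl dWV dE -raddfD; apply: diag_nonincreasing_diag => i j ij.
rewrite !mxE; have [wij|wij] := eqVneq (w 0 i) (w 0 j).
  by rewrite wij lerD2l eP.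
have /gP gij : w 0 j < w 0 i by rewrite lt_neqAle eq_sym wij wP.
by have := ec i; have := ec j; rewrite !ler_norml => /andP[? ?] /andP[? ?]; lra.
Qed.

End Perturbation.

(** * Extreme points and the normal cone *)

Lemma convex_hull_sub {R : realType} (E : lmodType R) (C : set E) : C `<=` convex_hull C.
Proof.
move=> x Cx; exists 1%N, (fun=> 1), (fun=> x).
by split=> //; rewrite big_ord1 ?scale1r.
Qed.

(** A convex combination giving x puts a weight t_i > 0 on some p_i. If t_i = 1
    then x = p_i; otherwise x lies strictly between p_i and the renormalized
    combination of the other points, and extremality gives p_i = x. *)
Lemma extreme_point_hull {R : realType} (E : lmodType R) (C : set E) x :
  extreme_point (convex_hull C) x -> C x.
Proof.
move=> [[k [t [p [t0 t1 Cp xE]]]] ext].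
have [i ti] : exists i, 0 < t i.
  apply/existsP; apply: contraT => /existsPn H.
  have : \sum_i t i <= 0 by apply: sumr_le0 => i _; rewrite leNgt.
  by rewrite t1 ler10.
have tE : t i + \sum_(j | j != i) t j = 1 by rewrite -t1 [RHS](bigD1 i).
have [ti1|ti1] := eqVneq (t i) 1.
  have z j : j != i -> t j = 0.
    move=> ji; apply/eqP; rewrite eq_le t0 andbT.
    have : \sum_(j | j != i) t j = 0 by apply: (addrI (t i)); rewrite tE ti1 addr0.
    by rewrite (bigD1 j) //= => <-; rewrite lerDl sumr_ge0.
  rewrite xE (bigD1 i) //= ti1 scale1r big1 ?addr0 // => j /z ->.
  by rewrite scale0r.
have ti_lt1 : t i < 1.
  by rewrite lt_neqAle ti1 -tE lerDl sumr_ge0.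
pose s := 1 - t i.
have s0 : 0 < s by rewrite subr_gt0.
pose z := \sum_j (if j == i then 0 else t j / s) *: p j.
have : p i = x /\ z = x; last by case=> <-.
apply: (ext _ _ (t i)); last 2 first.
- by rewrite ti.
- rewrite xE (bigD1 i) //=; congr (_ + _).
  rewrite /z [X in _ = _ *: X](bigD1 i) //= eqxx scale0r add0r scaler_sumr.
  apply: eq_bigr => j ji.
  by rewrite (negPf ji) scalerA -/s mulrCA mulfV ?mulr1 // gt_eqF.
- exact: convex_hull_sub.
exists k, (fun j => if j == i then 0 else t j / s), p; split=> //.
  by move=> j; case: eqP => // _; rewrite divr_ge0 // ltW.
rewrite (bigD1 i) //= eqxx add0r.
under eq_bigr => j ji do rewrite (negPf ji).
rewrite -mulr_suml (_ : \sum_(j | _) _ = s) ?mulfV ?gt_eqF //.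
by rewrite /s -tE addrAC subrr add0r.
Qed.

Section NormalCone.
Context {R : realType} {n : nat}.
Implicit Types (M Q U V W X : 'M[R]_n).

(** The orbits of M and of W coincide, so a linear functional is maximal at W over
    the hull as soon as it is maximal at W over the orbit of W. *)
Lemma orbit_normal_coneE M W : M \is symmetricmx ->
  [set U *m M *m U^T | U in orthogonal_matrix] W ->
  normal_cone (schur_horn M) W =
    [set Q | Q \is symmetricmx /\ spectrally_comonotone Q W].
Proof.
move=> /symmetricmxP sM [U0 oU0 WE].
have sW : W^T = W by rewrite -WE !trmx_mul trmxK sM mulmxA.
apply/seteqP; split=> Q [/= sQ H]; split=> //.
  apply: trace_le_comonotone => //; first exact/symmetricmxP.
  move=> V oV; apply: H; apply: convex_hull_sub; exists (V *m U0).
    exact: orthogonalM.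
  by rewrite -WE trmx_mul !mulmxA.
move=> X [k [t [p [t0 t1 Cp ->]]]].
rewrite mulmx_sumr raddf_sum /=.
apply: (@le_trans _ _ (\sum_i t i * \tr (Q *m W))); last first.
  by rewrite -mulr_suml t1 mul1r.
apply: ler_sum => i _; rewrite -scalemxAr mxtraceZ ler_wpM2l //.
have [U oU <-] := Cp i.
have -> : U *m M *m U^T = (U *m U0^T) *m W *m (U *m U0^T)^T.
  by rewrite -WE trmx_mul trmxK !mulmxA !orthogonalKTr.
by apply: comonotone_trace_le => //; apply: orthogonalM => //; exact: orthogonalT.
Qed.

End NormalCone.

(** * Relative interior of the normal cone *)

Lemma mx_entry_le_norm {R : realType} m n (A : 'M[R]_(m, n)) i j : `|A i j| <= `|A|.
Proof.
rewrite [leRHS]/Num.norm /= mx_normrE.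
exact: (le_bigmax _ (fun ij => `|A ij.1 ij.2|) (i, j)).
Qed.

Section Relint.
Context {R : realType} {n : nat}.
Implicit Types (P Q W : 'M[R]_n).
Implicit Types K : set 'M[R]_n.

Lemma normal_coneD K W Q1 Q2 :
  normal_cone K W Q1 -> normal_cone K W Q2 -> normal_cone K W (Q1 + Q2).
Proof.
move=> [/symmetricmxP s1 H1] [/symmetricmxP s2 H2]; split=> [|X KX].
  by apply/symmetricmxP; rewrite raddfD /= s1 s2.
by rewrite !mulmxDl !mxtraceD lerD ?H1 ?H2.
Qed.

Lemma normal_coneZ K W Q (c : R) :
  0 <= c -> normal_cone K W Q -> normal_cone K W (c *: Q).
Proof.
move=> c0 [/symmetricmxP s H]; split=> [|X KX].
  by apply/symmetricmxP; rewrite linearZ /= s.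
by rewrite -!scalemxAl !mxtraceZ ler_wpM2l ?H.
Qed.

Lemma codiagonalizable_oppl W : W^T = W -> codiagonalizable [:: - W; W].
Proof.
move=> sW; have [U [w [oU dW _]]] := spectral sW.
have uU : U^T \in unitmx by case: (mulmx1_unit oU).
have e : U^T *m W = diag_mx w *m U^T by rewrite -dW orthogonalKr.
exists U^T => //=; rewrite andbT; apply/andP; split; apply/diagonalizable_forPex.
  by exists (- w); apply/(simmxP uU); rewrite mulmxN e raddfN mulNmx.
by exists w; apply/(simmxP uU).
Qed.

Lemma affine_hull_comonotone K W y :
  K `<=` [set Q | Q \is symmetricmx /\ spectrally_comonotone Q W] ->
  affine_hull K y -> y^T = y /\ y *m W = W *m y.
Proof.
move=> KE [k [t [p [_ Kp ->]]]]; split.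
  rewrite raddf_sum /=; apply: eq_bigr => i _.
  by rewrite linearZ /=; have [/symmetricmxP-> _] := KE _ (Kp i).
rewrite mulmx_suml mulmx_sumr; apply: eq_bigr => i _.
by rewrite -scalemxAl -scalemxAr; have [_ /comonotone_commute->] := KE _ (Kp i).
Qed.

(** Both inclusions move along the normal matrices W + E, with E small in the
    space of symmetric matrices commuting with W, and use that a normal cone is
    closed under sums and nonnegative scaling. *)
Lemma relint_normal_cone K W : W^T = W ->
  normal_cone K W = [set Q | Q \is symmetricmx /\ spectrally_comonotone Q W] ->
  relint (normal_cone K W) =
    [set Q | Q \is symmetricmx /\ strictly_spectrally_comonotone Q W].
Proof.
move=> sW NE; have [c c0 cP] := comonotone_perturb sW.
have perturbN E : E^T = E -> E *m W = W *m E -> (forall i j, `|E i j| <= c) ->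
    normal_cone K W (W + E).
  move=> sE cE Ec; rewrite NE; split; last exact: cP.
  by apply/symmetricmxP; rewrite raddfD /= sW sE.
have NW : normal_cone K W W.
  rewrite -[X in _ X]addr0; apply: perturbN; first exact: trmx0.
    by rewrite mulmx0 mul0mx.
  by move=> i j; rewrite mxE normr0 ltW.
apply/seteqP; split=> Q /=.
  move=> [NQ /nbhs_ballP[r /= r0 rP]]; split; first by case: NQ.
  move=> P /symmetricmxP sP /codiagonalizableP[/(_ P W) cPW _].
  have {}cPW : P *m W = W *m P by apply: cPW; rewrite !inE eqxx ?orbT.
  have P0 : 0 < `|P| + 1 by rewrite ltr_wpDl.
  pose e := r / (`|P| + 1); have e0 : 0 < e by rewrite divr_gt0.
  exists e => //; suff : normal_cone K W (Q + e *: P) by rewrite NE => -[].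
  apply: rP.
    rewrite -ball_normE /= opprD addrA subrr sub0r normrN normrZ gtr0_norm //.
    by rewrite /e mulrAC ltr_pdivrMr // ltr_pM2l // ltrDl.
  (* W + k P is normal, so Q + e P = Q + (e / k) (W + k P) - (e / k) W is an affine
     combination of three normal matrices. *)
  pose k := c / (`|P| + 1); have k0 : 0 < k by rewrite divr_gt0.
  exists 3%N, (fun i => nth 0 [:: 1; e / k; - (e / k)] i).
  exists (fun i => nth 0 [:: Q; W + k *: P; W] i); split.
  - by rewrite !big_ord_recl big_ord0 /=; lra.
  - case=> [[|[|[|]]]] //= _; apply: perturbN.
    + by rewrite linearZ /= sP.
    + by rewrite -scalemxAl -scalemxAr cPW.
    + move=> i j; rewrite mxE normrM gtr0_norm // /k mulrAC.
      rewrite ler_pdivrMr // ler_pM2l // (le_trans (mx_entry_le_norm _ _ _)) //.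
      by rewrite lerDl.
  - rewrite !big_ord_recl big_ord0 /= scale1r addr0 scaleNr scalerDr.
    by rewrite [_ + _ *: (k *: P)]addrC addrK scalerA divfK // gt_eqF.
move=> [/symmetricmxP sQ strQ].
have [||e e0 coZ] := strQ (- W).
- by apply/symmetricmxP; rewrite raddfN /= sW.
- exact: codiagonalizable_oppl.
have NZ : normal_cone K W (Q - e *: W).
  rewrite NE; split; last by rewrite -scalerN.
  by apply/symmetricmxP; rewrite raddfB /= sQ linearZ /= sW.
have NQ : normal_cone K W Q.
  rewrite -(subrK (e *: W) Q); apply: normal_coneD => //.
  by apply: normal_coneZ => //; exact: ltW.
split=> //; apply/nbhs_ballP; exists (e * c); first by rewrite /= mulr_gt0.
move=> y; rewrite -ball_normE /= => yQ ay.
have NE' : normal_cone K W `<=` [set Q | Q \is symmetricmx /\ spectrally_comonotone Q W].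
  by rewrite NE.
have [sy cy] := affine_hull_comonotone NE' ay.
have cQ : Q *m W = W *m Q by apply: comonotone_commute; case: (NE' _ NQ).
have -> : y = (Q - e *: W) + e *: (W + e^-1 *: (y - Q)).
  by rewrite scalerDr addrA subrK scalerA divff ?gt_eqF // scale1r addrC subrK.
apply: normal_coneD => //; apply: normal_coneZ; first exact: ltW.
apply: perturbN.
- by rewrite linearZ /= raddfB /= sy sQ.
- by rewrite -scalemxAl -scalemxAr mulmxBl mulmxBr cy cQ.
- move=> i j; rewrite mxE normrM gtr0_norm ?invr_gt0 // mulrC ler_pdivrMr //.
  apply: (le_trans (mx_entry_le_norm _ _ _)).
  by rewrite distrC mulrC ltW.
Qed.

End Relint.

Theorem proposition6 (R : realType) (n : nat) (M W : 'M[R]_n)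
    (hM : M \is symmetricmx) (hW : extreme_point (schur_horn M) W) :
  normal_cone (schur_horn M) W =
    [set Q | Q \is symmetricmx /\ spectrally_comonotone Q W] /\
  relint (normal_cone (schur_horn M) W) =
    [set Q | Q \is symmetricmx /\ strictly_spectrally_comonotone Q W].
Proof.
have [U oU WE] := extreme_point_hull hW.
have sW : W^T = W by rewrite -WE !trmx_mul trmxK (iffLR (symmetricmxP M) hM) mulmxA.
have NE : normal_cone (schur_horn M) W =
    [set Q | Q \is symmetricmx /\ spectrally_comonotone Q W].
  by apply: orbit_normal_coneE => //; exists U.
by split=> //; exact: relint_normal_cone.
Qed.
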